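(* Let $R$ and $S$ be associative rings and let ${}_SC_R$ be a semidualizing $(S,R)$-bimodule. The class $\mathcal{A}_C(R)$ contains the flat $R$-modules and the class $\mathcal{B}_C(S)$ contains the injective $S$-modules.
   Context: Rings are associative with unity (not necessarily commutative or noetherian). Modules are unital left modules; right $R$-modules are identified with left $R^{\mathrm{op}}$-modules. An $(S,R)$-bimodule $C={}_SC_R$ is semidualizing if: (a1) ${}_SC$ admits a degreewise finite $S$-projective resolution (a projective resolution by finitely generated projectives); (a2) $C_R$ admits a degreewise finite $R^{\mathrm{op}}$-projective resolution; (b1) the homothety map $S\to\operatorname{Hom}_{R^{\mathrm{op}}}(C,C)$, $s\mapsto(x\mapsto sx)$, is an isomorphism; (b2) the homothety map $R\to\operatorname{Hom}_S(C,C)$, $r\mapsto(x\mapsto xr)$, is an isomorphism; (c1) $\operatorname{Ext}_S^{i}(C,C)=0$ for all $i\geq1$; (c2) $\operatorname{Ext}_{R^{\mathrm{op}}}^{i}(C,C)=0$ for all $i\geq 1$. The Auslander class $\mathcal{A}_C(R)$ consists of all $R$-modules $M$ with (A1) $\operatorname{Tor}^R_i(C,M)=0$ for all $i\ge1$; (A2) $\operatorname{Ext}_S^i(C,C\otimes_RM)=0$ for all $i\ge1$; (A3) the natural map $\mu_M\colon M\to\operatorname{Hom}_S(C,C\otimes_RM)$, $m\mapsto(c\mapsto c\otimes m)$, is an isomorphism. The Bass class $\mathcal{B}_C(S)$ consists of all $S$-modules $N$ with (B1) $\operatorname{Ext}_S^i(C,N)=0$ for all $i\ge1$; (B2) $\operatorname{Tor}_i^R(C,\operatorname{Hom}_S(C,N))=0$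 for all $i\ge1$; (B3) the natural evaluation map $\nu_N\colon C\otimes_R\operatorname{Hom}_S(C,N)\to N$, $c\otimes f\mapsto f(c)$, is an isomorphism. *)

(* Defs.v *)
From HB Require Import structures.
From mathcomp Require Import all_boot all_order all_algebra.
From mathcomp Require Import ring_quotient.
From mathcomp Require Import boolp functions.
From mathcomp Require Import freeg.

Set Implicit Arguments.
Unset Strict Implicit.
Unset Printing Implicit Defensive.

Import GRing.Theory.
Local Open Scope ring_scope.
Local Open Scope quotient_scope.

(* Left R-modules are [lmodType R]; right R-modules are [lmodType R^c], where
   R^c is the opposite ring, so that [r *: x] in a right module reads "x r". *)

Section Hom.
Variables (R : pzRingType) (A B : lmodType R).

Definition hom_pred : {pred A -> B} := fun f => `[< linear f >].

Lemma hom_pred_closed : zmod_closed hom_pred.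
Proof.
split=> [|f g /asboolP fP /asboolP gP]; apply/asboolP => a x y.
  by rewrite scaler0 addr0.
by rewrite !fctE fP gP scalerBr opprD addrACA.
Qed.
HB.instance Definition _ :=
  GRing.isZmodClosed.Build (A -> B) hom_pred hom_pred_closed.

Record hom := Hom { hom_fun :> A -> B; hom_funP : hom_fun \in hom_pred }.

HB.instance Definition _ := [isSub for hom_fun].
HB.instance Definition _ := [Choice of hom by <:].
HB.instance Definition _ := [SubChoice_isSubZmodule of hom by <:].

Lemma hom_linear (f : hom) : linear f.
Proof. by apply/asboolP; exact: hom_funP. Qed.
HB.instance Definition _ (f : hom) :=
  GRing.isLinear.Build R A B *:%R (hom_fun f) (hom_linear f).

Definition mkhom (f : A -> B) (fP : linear f) : hom := Hom (asboolT fP).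

Lemma homP (f g : hom) : f =1 g -> f = g.
Proof. by move=> fg; apply/val_inj/funext. Qed.

Lemma hom0E x : (0 : hom) x = 0. Proof. by []. Qed.
Lemma homDE (f g : hom) x : (f + g) x = f x + g x. Proof. by []. Qed.
Lemma homNE (f : hom) x : (- f) x = - f x. Proof. by []. Qed.

End Hom.

Section HomPrecomp.
Variables (R : pzRingType) (A B N : lmodType R) (d : {linear A -> B}).

Definition precomp (f : hom B N) : hom A N := mkhom (linearP (f \o d)).

Lemma precomp_additive : zmod_morphism precomp.
Proof. by move=> f g; apply: homP. Qed.
HB.instance Definition _ :=
  GRing.isZmodMorphism.Build (hom B N) (hom A N) precomp precomp_additive.

End HomPrecomp.
Arguments precomp {R A B} N d.

Section Quot.
Variables (V : zmodType) (I : zmodClosed V).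

Lemma quot_piB x y :
  \pi_(Quotient.quot I) (x - y) = \pi x - \pi y :> Quotient.quot I.
Proof. by rewrite pi_addr pi_oppr. Qed.

Lemma quot_pi0P x : reflect (\pi_(Quotient.quot I) x = 0) (x \in I).
Proof.
have <- : \pi_(Quotient.quot I) 0 = 0 by rewrite pi_zeror.
by have := Quotient.idealrBE I x 0; rewrite subr0 => ->; exact: eqP.
Qed.
End Quot.

Section Tensor.
Variables (R : pzRingType) (A : lmodType R^c) (M : lmodType R).

Inductive tensor_rel : {freeg (A * M)%type / int} -> Prop :=
| tensor_rel0 : tensor_rel 0
| tensor_relB x y : tensor_rel x -> tensor_rel y -> tensor_rel (x - y)
| tensor_relDl a a' m :
    tensor_rel (<< (a + a', m) >> - << (a, m) >> - << (a', m) >>)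
| tensor_relDr a m m' :
    tensor_rel (<< (a, m + m') >> - << (a, m) >> - << (a, m') >>)
| tensor_relZ (r : R) a m :
    tensor_rel (<< ((r : R^c) *: a, m) >> - << (a, r *: m) >>).

Definition tensor_ker : {pred {freeg (A * M)%type / int}} :=
  fun x => `[< tensor_rel x >].

Lemma tensor_ker_closed : zmod_closed tensor_ker.
Proof.
split=> [|x y /asboolP xP /asboolP yP]; apply/asboolP.
  exact: tensor_rel0.
exact: tensor_relB.
Qed.
HB.instance Definition _ :=
  GRing.isZmodClosed.Build _ tensor_ker tensor_ker_closed.

Definition tensor : Type := Quotient.quot tensor_ker.
HB.instance Definition _ := GRing.Zmodule.on tensor.

Definition tens (a : A) (m : M) : tensor :=
  \pi_(Quotient.quot tensor_ker) << (a, m) >>.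


Lemma tens_rel0 x : tensor_rel x -> \pi_(Quotient.quot tensor_ker) x = 0.
Proof. by move=> xP; apply/quot_pi0P/asboolP. Qed.

Lemma tensDl a a' m : tens (a + a') m = tens a m + tens a' m.
Proof.
apply/eqP; rewrite -subr_eq0 opprD addrA /tens -!quot_piB.
by apply/eqP/tens_rel0; exact: tensor_relDl.
Qed.

Lemma tensBl m : zmod_morphism (tens^~ m).
Proof. by move=> a a'; apply: (addIr (tens a' m)); rewrite /= -tensDl !subrK. Qed.

Lemma tensDr a m m' : tens a (m + m') = tens a m + tens a m'.
Proof.
apply/eqP; rewrite -subr_eq0 opprD addrA /tens -!quot_piB.
by apply/eqP/tens_rel0; exact: tensor_relDr.
Qed.

Lemma tensZ (r : R) a m : tens ((r : R^c) *: a) m = tens a (r *: m).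
Proof.
apply/eqP; rewrite -subr_eq0 /tens -!quot_piB.
by apply/eqP/tens_rel0; exact: tensor_relZ.
Qed.

Definition balanced (B : zmodType) (f : A -> M -> B) : Prop :=
  [/\ forall a a' m, f (a + a') m = f a m + f a' m,
      forall a m m', f a (m + m') = f a m + f a m'
    & forall (r : R) a m, f ((r : R^c) *: a) m = f a (r *: m)].

Section Lift.
Variables (B : zmodType) (f : A -> M -> B) (fP : balanced f).

Let flift : {freeg (A * M)%type / int} -> zmodule B :=
  fglift (fun p => f p.1 p.2 : zmodule B).

Let fliftB x y : flift (x - y) = flift x - flift y.
Proof. exact: (lift_is_additive (fun p => f p.1 p.2 : zmodule B)). Qed.

Let fliftU a m : flift << (a, m) >> = f a m.
Proof. by rewrite /flift liftU scale1r. Qed.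

Let flift_rel x : tensor_rel x -> flift x = 0.
Proof.
case: fP => fDl fDr fZ; elim=> [|{}x y _ x0 _ y0|a a' m|a m m'|r a m].
- by rewrite -(subrr 0) fliftB subrr.
- by rewrite fliftB x0 y0 subrr.
- by rewrite !fliftB !fliftU fDl addrAC addrK subrr.
- by rewrite !fliftB !fliftU fDr addrAC addrK subrr.
- by rewrite !fliftB !fliftU fZ subrr.
Qed.

(* The proof argument serves to attach the additive structure below. *)
Definition tensor_lift of balanced f := fun t : tensor => flift (repr t) : B.

Let tensor_lift_pi x : tensor_lift fP (\pi_(Quotient.quot tensor_ker) x) = flift x.
Proof.
apply/eqP; rewrite -subr_eq0; apply/eqP; rewrite -[LHS]fliftB.
apply: flift_rel.
have /asboolP // : repr (\pi_(Quotient.quot tensor_ker) x) - x \in tensor_ker.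
by rewrite Quotient.idealrBE reprK.
Qed.

Lemma tensor_lift_additive : zmod_morphism (tensor_lift fP).
Proof.
move=> x y; rewrite -[x]reprK -[y]reprK.
by rewrite -[\pi _ - \pi _]quot_piB !tensor_lift_pi fliftB.
Qed.
HB.instance Definition _ :=
  GRing.isZmodMorphism.Build tensor B (tensor_lift fP) tensor_lift_additive.

Lemma tensor_liftE a m : tensor_lift fP (tens a m) = f a m.
Proof. by rewrite /tens tensor_lift_pi fliftU. Qed.
End Lift.

Lemma balanced_tens : balanced tens.
Proof. by split; [exact: tensDl | exact: tensDr | exact: tensZ]. Qed.

Lemma tensor_gen (t : tensor) :
  exists s : seq (A * M), t = \sum_(p <- s) tens p.1 p.2.
Proof.
pose T := Quotient.quot tensor_ker.
pose pi_t : {additive {freeg (A * M)%type / int} -> T} :=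
  HB.pack (\pi_T : _ -> T) (GRing.isZmodMorphism.Build _ _ _ (@quot_piB _ tensor_ker)).
have -> : t = pi_t (repr t) by rewrite /= reprK.
rewrite -(freeg_sumE (repr t)) raddf_sum.
elim: (dom _) => [|p r [s IHs]]; first by exists [::]; rewrite !big_nil.
rewrite big_cons IHs; exists ((p.1 *~ coeff p (repr t), p.2) :: s).
rewrite big_cons; congr (_ + _) => /=.
pose tl : {additive A -> T} :=
  HB.pack (fun a => tens a p.2 : T) (GRing.isZmodMorphism.Build _ _ _ (tensBl p.2)).
rewrite -[tens _ _]/(tl _) raddfMz -[coeff p _]intz -freegU_mulz intz.
by rewrite -[LHS]/(pi_t _) raddfMz /= /tens; case: p {tl}.
Qed.

Lemma tensor_additive_ext (B : zmodType) (f g : {additive tensor -> B}) :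
  (forall a m, f (tens a m) = g (tens a m)) -> f =1 g.
Proof.
move=> fg t; have [s ->] := tensor_gen t; rewrite !raddf_sum.
by apply: eq_bigr.
Qed.

End Tensor.

Section TensorMap.
Variables (R : pzRingType) (A B : lmodType R^c) (M : lmodType R).
Variable f : {linear A -> B}.

Lemma tensor_map_balanced : balanced (fun (a : A) (m : M) => tens (f a) m).
Proof.
split=> [a a' m|a m m'|r a m]; first by rewrite linearD tensDl.
- exact: tensDr.
- by rewrite linearZ tensZ.
Qed.

Definition tensor_map : {additive tensor A M -> tensor B M} :=
  tensor_lift tensor_map_balanced.

Lemma tensor_mapE a m : tensor_map (tens a m) = tens (f a) m.
Proof. exact: tensor_liftE. Qed.
End TensorMap.
Arguments tensor_map {R A B} M f.

Section Homology.

Definition exact_at (U V W : zmodType) (f : U -> V) (g : V -> W) : Prop :=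
  forall y, g y = 0 <-> exists x, f x = y.

Variables (U V W : zmodType) (f : {additive U -> V}) (g : {additive V -> W}).

Definition ker_pred : {pred V} := fun y => g y == 0.

Lemma ker_pred_closed : zmod_closed ker_pred.
Proof.
split=> [|x y /eqP x0 /eqP y0]; apply/eqP; first exact: raddf0.
by rewrite raddfB x0 y0 subrr.
Qed.
HB.instance Definition _ := GRing.isZmodClosed.Build V ker_pred ker_pred_closed.

Record ker := Ker { ker_val : V; ker_valP : ker_val \in ker_pred }.
HB.instance Definition _ := [isSub for ker_val].
HB.instance Definition _ := [Choice of ker by <:].
HB.instance Definition _ := [SubChoice_isSubZmodule of ker by <:].

Definition bound_pred : {pred ker} := fun z => `[< exists x, f x = ker_val z >].

Lemma bound_pred_closed : zmod_closed bound_pred.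
Proof.
split=> [|z w /asboolP[x xz] /asboolP[y yw]]; apply/asboolP.
  by exists 0; rewrite raddf0.
by exists (x - y); rewrite raddfB xz yw.
Qed.
HB.instance Definition _ :=
  GRing.isZmodClosed.Build ker bound_pred bound_pred_closed.

(* ker g / im f when g o f = 0, as is the case in all uses below. *)
Definition homology : zmodType := Quotient.quot bound_pred.

Lemma homology_eq0P :
  (forall h : homology, h = 0) <-> (forall y, g y = 0 -> exists x, f x = y).
Proof.
split=> [h0 y /eqP gy|fg h].
  have /quot_pi0P/asboolP[x xy] := h0 (\pi_(Quotient.quot bound_pred) (Ker gy)).
  by exists x.
rewrite -[h]reprK; apply/quot_pi0P/asboolP/fg/eqP; exact: ker_valP.
Qed.

End Homology.

Section Modules.
Variable R : pzRingType.
Implicit Types M P I : lmodType R.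

Definition fin_gen M : Prop :=
  exists (n : nat) (e : 'I_n -> M),
    forall x, exists c : 'I_n -> R, x = \sum_i c i *: e i.

Definition projective P : Prop :=
  forall (X Y : lmodType R) (g : {linear X -> Y}) (f : {linear P -> Y}),
    (forall y, exists x, g x = y) ->
    exists h : {linear P -> X}, forall p, g (h p) = f p.

Definition injective_module I : Prop :=
  forall (X Y : lmodType R) (g : {linear X -> Y}) (f : {linear X -> I}),
    injective g -> exists h : {linear Y -> I}, forall x, h (g x) = f x.

Definition flat M : Prop :=
  forall (X Y Z : lmodType R^c) (f : {linear X -> Y}) (g : {linear Y -> Z}),
    exact_at f g -> exact_at (tensor_map M f) (tensor_map M g).

Record projres M := ProjRes {
  pr_obj :> nat -> lmodType R;
  pr_d : forall n, {linear pr_obj n.+1 -> pr_obj n};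
  pr_aug : {linear pr_obj 0 -> M};
  pr_projective : forall n, projective (pr_obj n);
  pr_aug_surj : forall x, exists p, pr_aug p = x;
  pr_exact0 : exact_at (pr_d 0) pr_aug;
  pr_exactS : forall n, exact_at (pr_d n.+1) (pr_d n)
}.

Definition deg_finite M (P : projres M) : Prop := forall n, fin_gen (P n).

End Modules.

(* Ext^i_R(M, N), as the i-th cohomology of Hom_R(P, N) for a projective
   resolution P of M. *)
Definition Ext (R : pzRingType) (M N : lmodType R) (P : projres M) (i : nat) :
    zmodType :=
  match i with
  | 0 => homology (\0 : {additive hom (P 0) N -> hom (P 0) N})
                  (precomp N (pr_d P 0))
  | j.+1 => homology (precomp N (pr_d P j)) (precomp N (pr_d P j.+1))
  end.

(* Tor_i^R(A, M), as the i-th homology of P (x)_R M for a projective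
   resolution P of the right module A. *)
Definition Tor (R : pzRingType) (A : lmodType R^c) (M : lmodType R)
    (P : projres A) (i : nat) : zmodType :=
  match i with
  | 0 => homology (tensor_map M (pr_d P 0))
                  (\0 : {additive tensor (P 0) M -> tensor (P 0) M})
  | j.+1 => homology (tensor_map M (pr_d P j.+1)) (tensor_map M (pr_d P j))
  end.

(* Ext and Tor do not depend on the chosen resolution, so their vanishing is
   stated for every one of them.  In the definitions of semidualizing bimodules
   and of the Auslander and Bass classes the resolved module is always C, which
   has a projective resolution on both sides by the finiteness conditions. *)
Definition Ext_eq0 (R : pzRingType) (M N : lmodType R) (i : nat) : Prop :=
  forall (P : projres M) (x : Ext N P i), x = 0.

Definition Tor_eq0 (R : pzRingType) (A : lmodType R^c) (M : lmodType R)
    (i : nat) : Prop :=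
  forall (P : projres A) (x : Tor M P i), x = 0.

HB.mixin Record Lmodule_isBimodule (S R : pzRingType) C
    of GRing.Lmodule S C := {
  rscale : C -> R -> C;
  rscaleDl : forall (x y : C) r, rscale (x + y) r = rscale x r + rscale y r;
  rscaleDr : forall (x : C) r r', rscale x (r + r') = rscale x r + rscale x r';
  rscaleA : forall (x : C) r r', rscale (rscale x r) r' = rscale x (r * r');
  rscale1 : forall x : C, rscale x 1 = x;
  scale_rscaleA : forall (s : S) (x : C) r,
    s *: rscale x r = rscale (s *: x) r
}.

#[short(type="bimodType")]
HB.structure Definition Bimodule (S R : pzRingType) :=
  { C of Lmodule_isBimodule S R C & GRing.Lmodule S C }.

Section Bimodule.
Variables (S R : pzRingType) (C : bimodType S R).
Implicit Types (c : C) (s : S) (r : R).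

Definition rmod : Type := C.
HB.instance Definition _ := GRing.Zmodule.on rmod.

Lemma rmod_scaleA (a b : R^c) (x : rmod) :
  rscale (rscale (x : C) b) a = rscale (x : C) (a * b : R^c).
Proof. exact: rscaleA. Qed.
Lemma rmod_scale1 (x : rmod) : rscale (x : C) (1 : R^c) = x.
Proof. exact: rscale1. Qed.
Lemma rmod_scaleDr (a : R^c) (x y : rmod) :
  rscale (x + y : C) a = rscale (x : C) a + rscale (y : C) a.
Proof. exact: rscaleDl. Qed.
Lemma rmod_scaleDl (x : rmod) (a b : R^c) :
  rscale (x : C) (a + b : R^c) = rscale (x : C) a + rscale (x : C) b.
Proof. exact: rscaleDr. Qed.
HB.instance Definition _ :=
  @GRing.Zmodule_isLmodule.Build R^c rmod (fun r (x : rmod) => rscale (x : C) r)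
    rmod_scaleA rmod_scale1 rmod_scaleDr rmod_scaleDl.

Lemma homothety_l_linear s : linear (fun x : rmod => s *: (x : C) : rmod).
Proof.
move=> r x y; apply: etrans (scalerDr s (r *: x : C) (y : C)) _.
by congr (_ + _); exact: scale_rscaleA.
Qed.
Definition homothety_l s : hom rmod rmod := mkhom (homothety_l_linear s).

Section CHom.
Variable N : lmodType S.

Definition chom : Type := hom C N.
HB.instance Definition _ := GRing.Zmodule.on chom.

Lemma chom_scale_linear r (f : hom C N) : linear (fun c => f (rscale c r)).
Proof. by move=> s x y; rewrite rscaleDl -scale_rscaleA linearP. Qed.
Definition chom_scale r (f : chom) : chom := mkhom (chom_scale_linear r f).

Lemma chom_scaleA r r' f : chom_scale r (chom_scale r' f) = chom_scale (r * r') f.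
Proof. by apply: homP => c; rewrite /= rscaleA. Qed.
Lemma chom_scale1 : left_id 1 chom_scale.
Proof. by move=> f; apply: homP => c; rewrite /= rscale1. Qed.
Lemma chom_scaleDr : right_distributive chom_scale +%R.
Proof. by move=> r f g; apply: homP. Qed.
Lemma chom_scaleDl f : {morph chom_scale^~ f : r r' / r + r'}.
Proof. by move=> r r'; apply: homP => c; rewrite /= rscaleDr linearD. Qed.
HB.instance Definition _ := GRing.Zmodule_isLmodule.Build R chom
  chom_scaleA chom_scale1 chom_scaleDr chom_scaleDl.
End CHom.

Section CTensor.
Variable M : lmodType R.

Definition ctensor : Type := tensor rmod M.
HB.instance Definition _ := GRing.Zmodule.on ctensor.

Definition ctens (c : C) (m : M) : ctensor := tens (c : rmod) m.

Definition ctensor_scale s (t : ctensor) : ctensor :=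
  tensor_map M (homothety_l s) t.

Lemma ctensor_scaleA s s' t :
  ctensor_scale s (ctensor_scale s' t) = ctensor_scale (s * s') t.
Proof.
rewrite /ctensor_scale; have [w ->] := tensor_gen t; rewrite !raddf_sum.
apply: eq_bigr => p _; rewrite !tensor_mapE.
by congr (tens _ _); exact: (scalerA s s' (p.1 : C)).
Qed.
Lemma ctensor_scale1 : left_id 1 ctensor_scale.
Proof.
move=> t; rewrite /ctensor_scale; have [w ->] := tensor_gen t.
rewrite raddf_sum; apply: eq_bigr => p _; rewrite tensor_mapE.
by congr (tens _ _); exact: (scale1r (p.1 : C)).
Qed.
Lemma ctensor_scaleDr : right_distributive ctensor_scale +%R.
Proof. by move=> s t t'; exact: raddfD. Qed.
Lemma ctensor_scaleDl t : {morph ctensor_scale^~ t : s s' / s + s'}.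
Proof.
move=> s s'; rewrite /ctensor_scale; have [w ->] := tensor_gen t.
rewrite !raddf_sum -big_split; apply: eq_bigr => p _.
rewrite !tensor_mapE; apply: etrans (tensDl _ _ _).
by congr (tens _ _); exact: (scalerDl (p.1 : C) s s').
Qed.
HB.instance Definition _ := GRing.Zmodule_isLmodule.Build S ctensor
  ctensor_scaleA ctensor_scale1 ctensor_scaleDr ctensor_scaleDl.

Lemma ctens_scale s c m : s *: ctens c m = ctens (s *: c) m.
Proof. exact: tensor_mapE. Qed.
End CTensor.

Lemma homothety_r_linear r : linear (fun x : C => rscale x r).
Proof. by move=> s x y; rewrite rscaleDl -scale_rscaleA. Qed.
Definition homothety_r r : hom C C := mkhom (homothety_r_linear r).

Section Mu.
Variable M : lmodType R.

Lemma mu_hom_linear (m : M) : linear (fun c : C => ctens c m).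
Proof. by move=> s x y; rewrite ctens_scale; exact: tensDl. Qed.
Definition mu (m : M) : chom (ctensor M) := (mkhom (mu_hom_linear m) : hom C _).

Lemma mu_linear : linear mu.
Proof.
move=> r m m'; apply: homP => c.
rewrite [LHS]tensDr; congr (_ + _); exact/esym/tensZ.
Qed.
HB.instance Definition _ := GRing.isLinear.Build R M (chom (ctensor M)) *:%R mu
  mu_linear.
End Mu.

Section Nu.
Variable N : lmodType S.

Lemma nu_balanced : balanced (fun (c : rmod) (f : chom N) => (f : hom C N) c).
Proof. by split=> [c c' f|//|//]; exact: linearD. Qed.
Definition nu (t : ctensor (chom N)) : N := tensor_lift nu_balanced t.

Lemma nuE c f : nu (ctens c f) = (f : hom C N) c.
Proof. exact: tensor_liftE. Qed.

Lemma nu_linear : linear nu.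
Proof.
move=> s t t'; rewrite /nu raddfD; congr (_ + _).
pose lhs : {additive tensor rmod (chom N) -> N} :=
  tensor_lift nu_balanced \o tensor_map (chom N) (homothety_l s).
pose rhs : {additive tensor rmod (chom N) -> N} :=
  *:%R s \o tensor_lift nu_balanced.
apply: (tensor_additive_ext (f := lhs) (g := rhs)) => c f.
rewrite -[LHS]/(tensor_lift nu_balanced (tensor_map (chom N) _ (tens c f))).
rewrite tensor_mapE -[RHS]/(s *: tensor_lift nu_balanced (tens c f)).
by rewrite !tensor_liftE; exact: (linearZZ (f : hom C N) s (c : C)).
Qed.
HB.instance Definition _ := GRing.isLinear.Build S (ctensor (chom N)) N *:%R nu
  nu_linear.
End Nu.

(* In all three definitions the maps required to be isomorphisms are
   homomorphisms, so bijectivity is the whole condition. *)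

Record semidualizing : Prop := {
  semidualizing_a1 : exists P : projres (C : lmodType S), deg_finite P;
  semidualizing_a2 : exists P : projres (rmod : lmodType R^c), deg_finite P;
  semidualizing_b1 : bijective homothety_l;
  semidualizing_b2 : bijective homothety_r;
  semidualizing_c1 : forall i, (0 < i)%N -> @Ext_eq0 S C C i;
  semidualizing_c2 : forall i, (0 < i)%N -> @Ext_eq0 R^c rmod rmod i
}.

Record auslander (M : lmodType R) : Prop := {
  auslander_A1 : forall i, (0 < i)%N -> @Tor_eq0 R rmod M i;
  auslander_A2 : forall i, (0 < i)%N -> @Ext_eq0 S C (ctensor M) i;
  auslander_A3 : bijective (@mu M)
}.

Record bass (N : lmodType S) : Prop := {
  bass_B1 : forall i, (0 < i)%N -> @Ext_eq0 S C N i;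
  bass_B2 : forall i, (0 < i)%N -> @Tor_eq0 R rmod (chom N) i;
  bass_B3 : bijective (@nu N)
}.

End Bimodule.

(* Main.v *)
(* For a degreewise finite projective resolution P of C over S, the evaluation
   Hom_S(P_n, C) (x)_R F -> Hom_S(P_n, C (x)_R F) is bijective (dual bases give
   the inverse).  Since Ext_S^i(C, C) = 0 for i > 0, the complex Hom_S(P, C) is
   exact in positive degrees, and stays so after tensoring with a flat F; this
   gives the vanishing of Ext_S^i(C, C (x)_R F).  In degree 0 the same comparison
   shows that Hom_S(C, C) (x)_R F -> Hom_S(C, C (x)_R F) is bijective, and
   R = Hom_S(C, C) turns it into mu_F.  Dually, for a degreewise finite projective
   resolution Q of C over R^op and an injective I, the evaluation
   Q_n (x)_R Hom_S(C, I) -> Hom_S(Hom_{R^op}(Q_n, C), I) is bijective and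
   Hom_S(-, I) is exact.  Vanishing for one resolution extends to all of them by
   the comparison theorem. *)

Require Import Defs.
From HB Require Import structures.
From mathcomp Require Import all_boot all_algebra.
From mathcomp Require Import boolp.

Set Implicit Arguments.
Unset Strict Implicit.
Unset Printing Implicit Defensive.

Import GRing.Theory.
Local Open Scope ring_scope.
(* [vector] exports another [hom]. *)
Local Notation hom := Defs.hom.

Arguments pr_projective {R M} p n [X Y g].
Arguments pr_exact0 {R M} p.
Arguments pr_exactS {R M} p n.

(** * Lifting and extending linear maps along exact sequences *)

Section LinearImage.
Variables (R : pzRingType) (X Y : lmodType R) (f : {linear X -> Y}).

Definition limage_pred : {pred Y} := fun y => `[< exists x, f x = y >].

Lemma limage_pred_closed : submod_closed limage_pred.
Proof.
split=> [|a y z /asboolP[x <-] /asboolP[w <-]]; apply/asboolP.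
  by exists 0; exact: linear0.
by exists (a *: x + w); rewrite linearP.
Qed.
HB.instance Definition _ :=
  GRing.isSubmodClosed.Build R Y limage_pred limage_pred_closed.

(** Projectivity is stated for surjections, so the image of [f] has to be a module of its own, onto
    which [f] is surjective. *)
Record limage := LImage { limage_val : Y; limage_valP : limage_val \in limage_pred }.
HB.instance Definition _ := [isSub for limage_val].
HB.instance Definition _ := [Choice of limage by <:].
HB.instance Definition _ := [SubChoice_isSubLmodule of limage by <:].

Lemma limage_corestrict (P : lmodType R) (h : {linear P -> Y}) :
    (forall p, exists x, f x = h p) ->
  exists h' : {linear P -> limage}, forall p, val (h' p) = h p.
Proof.
move=> hf; pose h' p : limage := LImage (asboolT (hf p)).
have h'P : linear h' by move=> a p q; apply: val_inj; rewrite linearP /= linearP.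
by exists (mkhom h'P).
Qed.

(** Exactness puts the image of [h] inside that of [f]. After corestriction to this image [f] is
    surjective, and projectivity gives the lift. *)
Lemma lift_through_exact (Z P : lmodType R) (g : {linear Y -> Z}) (h : {linear P -> Y}) :
    projective P -> exact_at f g -> (forall p, g (h p) = 0) ->
  exists h' : {linear P -> X}, forall p, f (h' p) = h p.
Proof.
move=> Pproj fg gh.
have [h1 h1E] : exists h1 : {linear P -> limage}, forall p, val (h1 p) = h p.
  by apply: limage_corestrict => p; apply/fg.
have [f1 f1E] : exists f1 : {linear X -> limage}, forall p, val (f1 p) = f p.
  by apply: limage_corestrict => x; exists x.
have [y|h' h'E] := Pproj _ _ f1 h1.
  by have /asboolP[x xy] := limage_valP y; exists x; apply: val_inj; rewrite f1E.
by exists h' => p; rewrite -f1E h'E h1E.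
Qed.

End LinearImage.

(** Since [k] vanishes on the kernel of [g], it factors through the image of [g], a submodule of [Z]
    from which injectivity of [I] extends it. *)
Lemma extend_through_exact (R : pzRingType) (X Y Z I : lmodType R)
    (f : {linear X -> Y}) (g : {linear Y -> Z}) (k : {linear Y -> I}) :
    injective_module I -> exact_at f g -> (forall x, k (f x) = 0) ->
  exists k' : {linear Z -> I}, forall y, k' (g y) = k y.
Proof.
move=> Iinj fg kf.
have gE (z : limage g) : {y | g y = val z} by apply/cid/asboolP/(limage_valP z).
have k_inj y y' : g y = g y' -> k y = k y'.
  move=> gy; have /fg[x fx] : g (y - y') = 0 by rewrite linearB gy subrr.
  by apply/eqP; rewrite -subr_eq0 -linearB -fx kf.
(* The value goes through a chosen preimage under [g]; by [k_inj] the choice does not matter, whence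
   linearity. *)
pose k1 z := k (projT1 (gE z)).
have k1P : linear k1.
  move=> a z w; rewrite /k1 -linearP; apply: k_inj.
  by rewrite linearP !(projT2 (gE _)) linearP.
have val_inj : injective (val : {linear limage g -> Z}) by exact: val_inj.
have [k' k'E] := Iinj _ _ _ (mkhom k1P) val_inj.
have [g1 g1E] : exists g1 : {linear Y -> limage g}, forall p, val (g1 p) = g p.
  by apply: limage_corestrict => x; exists x.
exists k' => y; rewrite -g1E k'E; apply: k_inj.
by rewrite (projT2 (gE _)) g1E.
Qed.

(** Serves to build chain maps and homotopies degree by degree; [good] is the invariant that keeps
    the next choice possible. *)
Lemma dependent_choice_seq (T : nat -> Type) (good : forall n, T n -> Prop)
    (next : forall n, T n -> T n.+1 -> Prop) (x0 : T 0) :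
    good 0 x0 ->
    (forall n x, good n x -> exists y, next n x y /\ good n.+1 y) ->
  exists f : forall n, T n, f 0 = x0 /\ forall n, next n (f n) (f n.+1).
Proof.
move=> good0 goodS.
have step n (x : {x | good n x}) : {y : {y | good n.+1 y} | next n (sval x) (sval y)}.
  have /cid[y [xy yP]] := goodS _ _ (svalP x).
  by exists (exist _ y yP).
pose F := nat_rect (fun n => {x | good n x}) (exist _ x0 good0)
  (fun n x => sval (step n x)).
by exists (fun n => sval (F n)); split=> // n; exact: svalP (step n (F n)).
Qed.

(** * Comparison of projective resolutions and vanishing of Ext *)

Section Comparison.
Variables (R : pzRingType) (M : lmodType R).

Lemma projres_d_d (P : projres M) n (p : P n.+2) : pr_d P n (pr_d P n.+1 p) = 0.
Proof. by apply: (pr_exactS P n _).2; exists p. Qed.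

Lemma projres_aug_d (P : projres M) (p : P 1) : pr_aug P (pr_d P 0 p) = 0.
Proof. by apply: (pr_exact0 P _).2; exists p. Qed.

Lemma projres_chain_map (P Q : projres M) :
  exists phi : forall n, {linear P n -> Q n},
    (forall p, pr_aug Q (phi 0 p) = pr_aug P p) /\
    (forall n p, pr_d Q n (phi n.+1 p) = phi n (pr_d P n p)).
Proof.
have [phi0 phi0E] := pr_projective P 0 (pr_aug P) (pr_aug_surj Q).
(* The invariant says that [phi] after the differential of [P] lands in the kernel of the map
   leaving [Q n], which in degree 0 is the augmentation. Exactness of [Q] then provides the next
   lift. *)
pose good n : {linear P n -> Q n} -> Prop :=
  if n is m.+1 then fun phi => forall p, pr_d Q m (phi (pr_d P m.+1 p)) = 0
  else fun phi => forall p, pr_aug Q (phi (pr_d P 0 p)) = 0.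
pose next n (phi : {linear P n -> Q n}) (psi : {linear P n.+1 -> Q n.+1}) :=
  forall p, pr_d Q n (psi p) = phi (pr_d P n p).
have [||phi [phi_0 phiS]] := @dependent_choice_seq _ good next phi0.
- by move=> p; rewrite phi0E projres_aug_d.
- move=> n phi phiP.
  have [psi psiE] : exists psi : {linear P n.+1 -> Q n.+1}, next n phi psi.
    pose h : {linear P n.+1 -> Q n} := phi \o pr_d P n.
    case: n phi phiP @h => [|n] phi phiP h.
      exact: (lift_through_exact (h := h) (pr_projective P 1) (pr_exact0 Q) phiP).
    exact: (lift_through_exact (h := h) (pr_projective P n.+2) (pr_exactS Q n) phiP).
  by exists psi; split=> // p; rewrite psiE projres_d_d linear0.
- by exists phi; rewrite phi_0.
Qed.

Lemma projres_null_homotopy (P : projres M) (chi : forall n, {linear P n -> P n}) :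
    (forall p, pr_aug P (chi 0 p) = 0) ->
    (forall n p, pr_d P n (chi n.+1 p) = chi n (pr_d P n p)) ->
  exists s : forall n, {linear P n -> P n.+1},
    forall n p, chi n.+1 p = pr_d P n.+1 (s n.+1 p) + s n (pr_d P n p).
Proof.
move=> chi0 chiS.
have [s0 s0E] := lift_through_exact (pr_projective P 0) (pr_exact0 P) chi0.
(* The condition d s d = chi d is what makes chi - s d, one degree higher, take values in cycles;
   exactness then yields the next component of the homotopy. *)
pose good n : {linear P n -> P n.+1} -> Prop :=
  fun s => forall p, pr_d P n (s (pr_d P n p)) = chi n (pr_d P n p).
pose next n (s : {linear P n -> P n.+1}) (s' : {linear P n.+1 -> P n.+2}) :=
  forall p, chi n.+1 p = pr_d P n.+1 (s' p) + s (pr_d P n p).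
have [||s [_ sS]] := @dependent_choice_seq _ good next s0; last by exists s.
- by move=> p; rewrite s0E.
- move=> n s sP.
  pose h : {linear P n.+1 -> P n.+1} := chi n.+1 \- (s \o pr_d P n).
  have [p|s' s'E] :=
    lift_through_exact (h := h) (pr_projective P n.+1) (pr_exactS P n).
    by rewrite /= linearB chiS sP subrr.
  exists s'; split=> p; first by rewrite s'E /= subrK.
  by rewrite s'E /= projres_d_d linear0 subr0.
Qed.

(** Both chain maps lift the identity of [M], so the identity minus their composite lies over zero
    and is null-homotopic. *)
Lemma projres_homotopy_equiv (P Q : projres M) :
  exists (phi : forall n, {linear P n -> Q n}) (psi : forall n, {linear Q n -> P n})
    (s : forall n, {linear P n -> P n.+1}),
    [/\ forall n p, pr_d Q n (phi n.+1 p) = phi n (pr_d P n p),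
        forall n q, pr_d P n (psi n.+1 q) = psi n (pr_d Q n q)
      & forall n p, p = psi n.+1 (phi n.+1 p)
                        + (pr_d P n.+1 (s n.+1 p) + s n (pr_d P n p))].
Proof.
have [phi [phi0 phiS]] := projres_chain_map P Q.
have [psi [psi0 psiS]] := projres_chain_map Q P.
pose chi n : {linear P n -> P n} := idfun \- (psi n \o phi n).
have [p|n p|s sE] := @projres_null_homotopy P chi.
- by rewrite /= linearB psi0 phi0 subrr.
- by rewrite /= linearB psiS phiS.
- by exists phi, psi, s; split=> // n p; rewrite -sE /= addrC subrK.
Qed.

Lemma Ext_eq0_projres (N : lmodType R) (Q : projres M) j :
  (forall x : Ext N Q j.+1, x = 0) -> Ext_eq0 M N j.+1.
Proof.
move=> /homology_eq0P QN P; apply/homology_eq0P => f fd.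
have [phi [psi [s [phiS psiS sE]]]] := projres_homotopy_equiv P Q.
have [|h hE] := QN (precomp N (psi j.+1) f).
  apply: homP => q /=; rewrite -psiS.
  by have /(congr1 (fun k : hom _ _ => k (psi j.+2 q))) := fd.
(* From f psi = h d follows f psi phi = h phi d. Of the two homotopy terms, f d s vanishes because
   [f] is a cocycle, and f s d gives the second summand. *)
exists (precomp N (phi j) h + precomp N (s j) f); apply: homP => p.
rewrite -[LHS]/(h (phi j (pr_d P j p)) + f (s j (pr_d P j p))).
rewrite [p in RHS](sE j) 2!linearD /= -phiS.
have /(congr1 (fun k : hom _ _ => k (phi j.+1 p))) /= -> := hE.
have /(congr1 (fun k : hom _ _ => k (s j.+1 p))) /= -> := fd.
by rewrite add0r.
Qed.

End Comparison.

(** * Functoriality of the tensor product and vanishing of Tor *)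

Section TensorFunctor.
Variables (R : pzRingType) (M : lmodType R).
Implicit Types A B D : lmodType R^c.

Lemma tensor_map_comp A B D (f : {linear A -> B}) (g : {linear B -> D}) t :
  tensor_map M g (tensor_map M f t) = tensor_map M (g \o f) t.
Proof.
pose lhs : {additive tensor A M -> tensor D M} := tensor_map M g \o tensor_map M f.
apply: (tensor_additive_ext (f := lhs)) => a m.
by rewrite /= !tensor_liftE.
Qed.

Lemma eq_tensor_map A B (f g : {linear A -> B}) t :
  f =1 g -> tensor_map M f t = tensor_map M g t.
Proof.
by move=> fg; apply: tensor_additive_ext => a m; rewrite !tensor_mapE fg.
Qed.

Lemma tensor_mapD A B (f g : {linear A -> B}) t :
  tensor_map M (f \+ g) t = tensor_map M f t + tensor_map M g t.
Proof.
apply: (tensor_additive_ext (g := tensor_map M f \+ tensor_map M g)) => a m.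
by rewrite /= !tensor_liftE tensDl.
Qed.

Lemma tensor_map0 A B t : tensor_map M (\0 : {linear A -> B}) t = 0.
Proof.
apply: (tensor_additive_ext (g := \0)) => a m.
by rewrite tensor_mapE; apply: (addIr (tens 0 m)); rewrite -tensDl !add0r.
Qed.

Lemma tensor_map_id A t : tensor_map M (idfun : {linear A -> A}) t = t.
Proof.
by apply: (tensor_additive_ext (g := idfun)) => a m; rewrite tensor_mapE.
Qed.

Lemma tensor_map_surj A B (f : {linear A -> B}) :
  (forall b, exists a, f a = b) -> forall t, exists u, tensor_map M f u = t.
Proof.
move=> f_surj t; have [s ->] := tensor_gen t.
elim: s => [|[b m] s [u uE]]; first by exists 0; rewrite big_nil raddf0.
have [a fa] := f_surj b.
by exists (tens a m + u); rewrite raddfD big_cons uE /= tensor_mapE fa.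
Qed.

Lemma Tor_eq0_projres A (Q : projres A) j :
  (forall x : Tor M Q j.+1, x = 0) -> Tor_eq0 A M j.+1.
Proof.
move=> /homology_eq0P QN P; apply/homology_eq0P => t dt.
have [phi [psi [s [phiS psiS sE]]]] := projres_homotopy_equiv P Q.
have [|u uE] := QN (tensor_map M (phi j.+1) t).
  rewrite tensor_map_comp (eq_tensor_map (g := phi j \o pr_d P j)); last exact: phiS.
  by rewrite -tensor_map_comp dt raddf0.
(* Since d t = 0, the cycle [t] differs from its image under psi phi by the boundary of s t, and
   that image is the boundary of psi u. *)
exists (tensor_map M (psi j.+2) u + tensor_map M (s j.+1) t).
rewrite raddfD tensor_map_comp (eq_tensor_map (g := psi j.+1 \o pr_d Q j.+1)); last exact: psiS.
rewrite -tensor_map_comp uE -[RHS]tensor_map_id.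
rewrite (eq_tensor_map (f := idfun)
  (g := (psi j.+1 \o phi j.+1) \+ ((pr_d P j.+1 \o s j.+1) \+ (s j \o pr_d P j)))).
  by rewrite !tensor_mapD -!tensor_map_comp dt raddf0 addr0.
exact: sE.
Qed.

End TensorFunctor.

(** * Finite sums and dual bases *)

Definition hom_at (R : pzRingType) (A B : lmodType R) (x : A) (h : hom A B) : B := h x.

Lemma hom_at_additive (R : pzRingType) (A B : lmodType R) (x : A) :
  zmod_morphism (@hom_at R A B x).
Proof. by []. Qed.
HB.instance Definition _ (R : pzRingType) (A B : lmodType R) (x : A) :=
  GRing.isZmodMorphism.Build (hom A B) B (hom_at x) (@hom_at_additive R A B x).

Lemma hom_sumE (R : pzRingType) (A B : lmodType R) n (h : 'I_n -> hom A B) x :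
  (\sum_i h i) x = \sum_i h i x.
Proof. exact: (raddf_sum (hom_at x)). Qed.

Lemma tens_suml (R : pzRingType) (A : lmodType R^c) (M : lmodType R) n
    (a : 'I_n -> A) (m : M) : tens (\sum_i a i) m = \sum_i tens (a i) m.
Proof.
pose tl : {additive A -> tensor A M} :=
  HB.pack (fun a => tens a m) (GRing.isZmodMorphism.Build _ _ _ (@tensBl _ A M m)).
exact: (raddf_sum tl).
Qed.

(** A finite generating family gives a surjection from a finite free module; projectivity splits it,
    and the coordinates of the splitting are the dual functionals. *)
Lemma dual_basis (R : pzRingType) (P : lmodType R) :
    projective P -> fin_gen P ->
  exists n (e : 'I_n -> P) (phi : 'I_n -> {linear P -> R^o}),
    forall x, \sum_i (phi i x : R) *: e i = x.
Proof.
move=> Pproj [n [e eP]].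
pose g (v : {ffun 'I_n -> R^o}) : P := \sum_i (v i : R) *: e i.
have gP : linear g.
  move=> a v w; rewrite /g scaler_sumr -big_split; apply: eq_bigr => i _.
  by rewrite !ffunE scalerDl scalerA.
have [x|h hE] := Pproj _ _ (mkhom gP) idfun.
  by have [c ->] := eP x; exists [ffun i => c i]; apply: eq_bigr => i _; rewrite ffunE.
have phiP i : linear (fun x => h x i : R^o) by move=> a x y; rewrite linearP !ffunE.
by exists n, e, (fun i => mkhom (phiP i)) => x; exact: hE.
Qed.

(** * Evaluation maps for finitely generated projective modules *)

Section HomBimodule.
Variables (S R : pzRingType) (C : bimodType S R).

Section HomRight.
Variable P : lmodType S.

(* Hom_S(P, C) with the right R-module structure inherited from C. *)
Definition homr : Type := hom P C.
HB.instance Definition _ := GRing.Zmodule.on homr.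

Definition homr_scale (r : R^c) (g : homr) : homr :=
  mkhom (linearP (homothety_r C r \o (g : hom P C))).

Lemma homr_scaleA r r' g : homr_scale r (homr_scale r' g) = homr_scale (r * r') g.
Proof. by apply: homP => p; rewrite /= rscaleA. Qed.
Lemma homr_scale1 : left_id 1 homr_scale.
Proof. by move=> g; apply: homP => p; rewrite /= rscale1. Qed.
Lemma homr_scaleDr : right_distributive homr_scale +%R.
Proof. by move=> r f g; apply: homP => p; exact: rscaleDl. Qed.
Lemma homr_scaleDl g : {morph homr_scale^~ g : r r' / r + r'}.
Proof. by move=> r r'; apply: homP => p; exact: rscaleDr. Qed.
HB.instance Definition _ := GRing.Zmodule_isLmodule.Build R^c homr
  homr_scaleA homr_scale1 homr_scaleDr homr_scaleDl.
End HomRight.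

Section HomLeft.
Variable Q : lmodType R^c.

(* Hom_{R^op}(Q, C) with the left S-module structure inherited from C. *)
Definition homl : Type := hom Q (rmod C).
HB.instance Definition _ := GRing.Zmodule.on homl.

Definition homl_scale (s : S) (g : homl) : homl :=
  mkhom (linearP (homothety_l C s \o (g : hom Q (rmod C)))).

Lemma homl_scaleA s s' g : homl_scale s (homl_scale s' g) = homl_scale (s * s') g.
Proof. by apply: homP => q; exact: (scalerA s s' (_ : C)). Qed.
Lemma homl_scale1 : left_id 1 homl_scale.
Proof. by move=> g; apply: homP => q; exact: (scale1r (_ : C)). Qed.
Lemma homl_scaleDr : right_distributive homl_scale +%R.
Proof. by move=> s f g; apply: homP => q; exact: (scalerDr s (_ : C)). Qed.
Lemma homl_scaleDl g : {morph homl_scale^~ g : s s' / s + s'}.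
Proof. by move=> s s'; apply: homP => q; exact: (scalerDl (_ : C)). Qed.
HB.instance Definition _ := GRing.Zmodule_isLmodule.Build S homl
  homl_scaleA homl_scale1 homl_scaleDr homl_scaleDl.
End HomLeft.

Lemma homr_map_linear (A B : lmodType S) (d : {linear A -> B}) :
  linear (precomp C d : homr B -> homr A).
Proof. by move=> r f g; apply: homP. Qed.
Definition homr_map (A B : lmodType S) (d : {linear A -> B}) : {linear homr B -> homr A} :=
  mkhom (homr_map_linear d).

Lemma homl_map_linear (A B : lmodType R^c) (d : {linear A -> B}) :
  linear (precomp (rmod C) d : homl B -> homl A).
Proof. by move=> s f g; apply: homP. Qed.
Definition homl_map (A B : lmodType R^c) (d : {linear A -> B}) : {linear homl B -> homl A} :=
  mkhom (homl_map_linear d).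

Section TensorEval.
Variable F : lmodType R.

Definition tensor_eval_hom (P : lmodType S) (g : homr P) (m : F) : hom P (ctensor C F) :=
  mkhom (linearP ((mu C m : hom C (ctensor C F)) \o (g : hom P C))).

Lemma tensor_eval_balanced P : balanced (@tensor_eval_hom P).
Proof.
split=> [g g' m|g m m'|r g m]; apply: homP => p.
- exact: tensDl.
- exact: tensDr.
- exact: tensZ.
Qed.

Definition tensor_eval P : {additive tensor (homr P) F -> hom P (ctensor C F)} :=
  tensor_lift (@tensor_eval_balanced P).

Lemma tensor_evalE P (g : homr P) m p :
  tensor_eval P (tens g m) p = ctens ((g : hom P C) p) m.
Proof. by rewrite [tensor_eval P _]tensor_liftE. Qed.

Lemma tensor_eval_natural (A B : lmodType S) (d : {linear A -> B}) t :
  tensor_eval A (tensor_map F (homr_map d) t) = precomp _ d (tensor_eval B t).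
Proof.
pose lhs : {additive _ -> _} := tensor_eval A \o tensor_map F (homr_map d).
pose rhs : {additive _ -> _} := precomp _ d \o tensor_eval B.
apply: (tensor_additive_ext (f := lhs) (g := rhs)) => g m; apply: homP => p.
by rewrite /= !tensor_liftE.
Qed.

(** With a dual basis e_i, phi_i, the inverse sends h to the sum of the images of h(e_i) under lam_i
    (x) F, where lam_i(c) = phi_i(-) c. Using the induced map on tensors avoids decomposing h(e_i)
    into pure tensors. *)
Lemma tensor_eval_bij P : projective P -> fin_gen P -> bijective (tensor_eval P).
Proof.
move=> Pproj Pfg; have [n [e [phi phiE]]] := dual_basis Pproj Pfg.
have lamP1 i (c : C) : linear (fun p => (phi i p : S) *: c).
  by move=> a p q; rewrite linearP scalerDl scalerA.
pose lam i (c : rmod C) : homr P := mkhom (lamP1 i c).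
have lamP i : linear (lam i).
  move=> r c c'; apply: homP => p; apply: etrans (scalerDr _ _ _) _.
  by congr (_ + _); exact: scale_rscaleA.
have lam_eval i (t : ctensor C F) p :
    tensor_eval P (tensor_map F (mkhom (lamP i)) t) p = (phi i p : S) *: t.
  pose lhs : {additive _ -> _} := hom_at p \o (tensor_eval P \o tensor_map F (mkhom (lamP i))).
  pose rhs : {additive ctensor C F -> _} := *:%R (phi i p : S).
  apply: (tensor_additive_ext (f := lhs) (g := rhs)) => c m.
  rewrite -[LHS]/(tensor_eval P (tensor_map F _ _) p) tensor_mapE tensor_evalE.
  exact/esym/ctens_scale.
pose inv (h : hom P (ctensor C F)) : tensor (homr P) F :=
  \sum_i tensor_map F (mkhom (lamP i)) (h (e i) : ctensor C F).
have inv_additive : zmod_morphism inv.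
  by move=> h h'; rewrite /inv -sumrB; apply: eq_bigr => i _; rewrite -raddfB.
exists inv => [t|h].
  pose inva : {additive hom P (ctensor C F) -> tensor (homr P) F} :=
    HB.pack inv (GRing.isZmodMorphism.Build _ _ _ inv_additive).
  pose lhs : {additive _ -> _} := inva \o tensor_eval P.
  apply: (tensor_additive_ext (f := lhs) (g := idfun)) => g m.
  rewrite -[LHS]/(inv _) /inv.
  under eq_bigr => i _ do rewrite tensor_evalE tensor_mapE.
  (* On a pure tensor the second factor is constant, so what remains is that g(p) is the sum of the
     phi_i(p) g(e_i). *)
  rewrite -tens_suml; congr tens; apply: homP => p.
  rewrite hom_sumE -[p in RHS]phiE linear_sum.
  by apply: eq_bigr => i _; rewrite linearZ.
apply: homP => p; rewrite /inv raddf_sum hom_sumE -[p in RHS]phiE linear_sum.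
by apply: eq_bigr => i _; rewrite lam_eval linearZ.
Qed.

End TensorEval.

Section HomEval.
Variable I : lmodType S.

Lemma hom_eval_linear (Q : lmodType R^c) (q : Q) (f : chom C I) :
  linear (fun g : homl Q => (f : hom C I) ((g : hom Q (rmod C)) q : C)).
Proof. by move=> s g g'; exact: (linearP (f : hom C I)). Qed.

Lemma hom_eval_balanced (Q : lmodType R^c) : balanced (fun q f => mkhom (@hom_eval_linear Q q f)).
Proof.
split=> [q q' f|q f f'|r q f]; apply: homP => g //=.
- by rewrite linearD; exact: (linearD (f : hom C I)).
- by rewrite linearZ.
Qed.

Definition hom_eval (Q : lmodType R^c) : {additive tensor Q (chom C I) -> hom (homl Q) I} :=
  tensor_lift (@hom_eval_balanced Q).

Lemma hom_evalE (Q : lmodType R^c) (q : Q) (f : chom C I) (g : homl Q) :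
  hom_eval Q (tens q f) g = (f : hom C I) ((g : hom Q (rmod C)) q : C).
Proof. by rewrite [hom_eval Q _]tensor_liftE. Qed.

Lemma hom_eval_natural (A B : lmodType R^c) (d : {linear A -> B}) t :
  hom_eval B (tensor_map (chom C I) d t) = precomp I (homl_map d) (hom_eval A t).
Proof.
pose lhs : {additive _ -> _} := hom_eval B \o tensor_map (chom C I) d.
pose rhs : {additive _ -> _} := precomp I (homl_map d) \o hom_eval A.
apply: (tensor_additive_ext (f := lhs) (g := rhs)) => q f; apply: homP => g.
by rewrite /= !tensor_liftE.
Qed.

(** With a dual basis e_i, phi_i of [Q], the inverse sends k to the sum of the e_i (x) (c |-> k(c
    phi_i(-))). *)
Lemma hom_eval_bij (Q : lmodType R^c) : projective Q -> fin_gen Q -> bijective (hom_eval Q).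
Proof.
move=> Qproj Qfg; have [n [e [phi phiE]]] := dual_basis Qproj Qfg.
have lamP i (c : C) : linear (fun q => (phi i q : R^c) *: (c : rmod C)).
  by move=> a p q; rewrite linearP scalerDl scalerA.
pose lam i c : homl Q := mkhom (lamP i c).
(* Linearity over [S] comes from the two actions on [C] commuting. *)
have kP i (k : hom (homl Q) I) : linear (fun c => k (lam i c)).
  move=> s c c'; rewrite -linearP; congr (k _); apply: homP => q.
  apply: etrans (scalerDr (phi i q : R^c) _ _) _.
  by congr (_ + _); exact/esym/scale_rscaleA.
pose inv (k : hom (homl Q) I) : tensor Q (chom C I) :=
  \sum_i tens (e i) (mkhom (kP i k) : chom C I).
have inv_additive : zmod_morphism inv.
  move=> k k'; rewrite /inv -sumrB; apply: eq_bigr => i _.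
  apply: (addIr (tens (e i) (mkhom (kP i k') : chom C I))).
  by rewrite subrK -tensDr; congr tens; apply: homP => c; exact: subrK.
exists inv => [t|k].
  pose inva : {additive hom (homl Q) I -> tensor Q (chom C I)} :=
    HB.pack inv (GRing.isZmodMorphism.Build _ _ _ inv_additive).
  pose lhs : {additive _ -> _} := inva \o hom_eval Q.
  apply: (tensor_additive_ext (f := lhs) (g := idfun)) => q f.
  rewrite -[LHS]/(inv _) /inv -[q in RHS]phiE tens_suml.
  (* The coefficient phi_i(q) crosses the tensor sign and acts on [f] through the right action on
     [C]. *)
  apply: eq_bigr => i _; rewrite tensZ; congr tens; apply: homP => c.
  by rewrite /= hom_evalE.
apply: homP => g; rewrite /inv raddf_sum hom_sumE.
under eq_bigr => i _ do rewrite hom_evalE /=.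
rewrite -linear_sum; congr (k _); apply: homP => q.
rewrite hom_sumE -[q in RHS]phiE linear_sum.
by apply: eq_bigr => i _; rewrite linearZ.
Qed.

End HomEval.

End HomBimodule.

(** * Left exactness of Hom, and exactness from vanishing Ext *)

Lemma tensBr (R : pzRingType) (A : lmodType R^c) (M : lmodType R) (a : A) :
  zmod_morphism (tens a : M -> tensor A M).
Proof. by move=> m m'; apply: (addIr (tens a m')); rewrite -tensDr !subrK. Qed.

(** A map that kills the image of [f] is constant on the fibres of [g], hence descends to [Z].
    Surjectivity of [g] takes the place that injectivity of the target has in
    [extend_through_exact]. *)
Lemma precomp_left_exact (R : pzRingType) (X Y Z N : lmodType R)
    (f : {linear X -> Y}) (g : {linear Y -> Z}) :
    exact_at f g -> (forall z, exists y, g y = z) ->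
  exact_at (precomp N g) (precomp N f).
Proof.
move=> fg g_surj k; split=> [kf|[k' <-]]; last first.
  by apply: homP => x /=; rewrite (fg (f x)).2 ?linear0 //; exists x.
have gE z : {y | g y = z} by exact/cid/g_surj.
have k_inj y y' : g y = g y' -> k y = k y'.
  move=> gy; have /fg[x fx] : g (y - y') = 0 by rewrite linearB gy subrr.
  apply/eqP; rewrite -subr_eq0 -linearB -fx.
  exact/eqP/(congr1 (hom_at x) kf).
pose k' z := k (projT1 (gE z)).
have k'P : linear k'.
  move=> a z w; rewrite /k' -linearP; apply: k_inj.
  by rewrite linearP !(projT2 (gE _)).
exists (mkhom k'P); apply: homP => y; apply: k_inj.
exact: (projT2 (gE _)).
Qed.

Lemma Ext_eq0_exact (R : pzRingType) (M N : lmodType R) (P : projres M) j :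
  Ext_eq0 M N j.+1 -> exact_at (precomp N (pr_d P j)) (precomp N (pr_d P j.+1)).
Proof.
move=> ExtN y; split=> [|[x <-]]; first by have /homology_eq0P := ExtN P; apply.
by apply: homP => p /=; rewrite projres_d_d linear0.
Qed.

(** * Flat modules lie in the Auslander class *)

Section FlatAuslander.
Variables (S R : pzRingType) (C : bimodType S R) (F : lmodType R).
Hypotheses (hC : semidualizing C) (Fflat : flat F).

(** Injectivity of [f] is exactness at [A] of the zero map followed by [f], and the zero map stays
    zero after tensoring. *)
Lemma flat_tensor_map_inj (A B : lmodType R^c) (f : {linear A -> B}) :
  injective f -> forall t, tensor_map F f t = 0 -> t = 0.
Proof.
move=> f_inj t ft.
have f0 : exact_at (\0 : {linear A -> A}) f.
  move=> a; split=> [fa|[x <-]]; last exact: linear0.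
  by exists 0; apply: f_inj; rewrite fa linear0.
have [t' <-] := (Fflat f0 t).1 ft.
exact: tensor_map0.
Qed.

Lemma flat_Tor_eq0 (A : lmodType R^c) j : Tor_eq0 A F j.+1.
Proof.
by move=> P; apply/homology_eq0P => t dt; apply/(Fflat (pr_exactS P j)).
Qed.

Lemma flat_Ext_eq0 j : Ext_eq0 (C : lmodType S) (ctensor C F) j.+1.
Proof.
have [P Pfin] := semidualizing_a1 hC.
apply: (Ext_eq0_projres (Q := P)); apply/homology_eq0P => h dh.
have ev_bij n := tensor_eval_bij C F (pr_projective P n) (Pfin n).
have [inv _ invK] := ev_bij j.+1.
(* The maps [homr_map] and [precomp] agree as functions, so exactness carries over to right
   [R]-modules, where flatness can be applied. *)
have CC : exact_at (homr_map C (pr_d P j)) (homr_map C (pr_d P j.+1)).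
  by apply: Ext_eq0_exact; exact: semidualizing_c1.
have [|u uE] := (Fflat CC (inv h)).1.
  apply: (bij_inj (ev_bij j.+2)).
  by rewrite tensor_eval_natural invK dh raddf0.
by exists (tensor_eval C F _ u); rewrite -[LHS]tensor_eval_natural uE invK.
Qed.

(** [C] need not be projective over [S], so the bijection is deduced from degrees 0 and 1 of a
    resolution by comparing two left exact sequences. *)
Lemma flat_tensor_eval_bij : bijective (tensor_eval C F (C : lmodType S)).
Proof.
have [P Pfin] := semidualizing_a1 hC.
have ev_bij n := tensor_eval_bij C F (pr_projective P n) (Pfin n).
have aug_inj (N : lmodType S) : injective (precomp N (pr_aug P)).
  move=> f g fg; apply: homP => c; have [p <-] := pr_aug_surj P c.
  exact: (congr1 (hom_at p) fg).
have augE : exact_at (homr_map C (pr_aug P)) (homr_map C (pr_d P 0)).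
  exact: (precomp_left_exact (pr_exact0 P) (pr_aug_surj P)).
have ev_inj : injective (tensor_eval C F (C : lmodType S)).
  apply: raddf_inj => t evt.
  apply: (flat_tensor_map_inj (f := homr_map C (pr_aug P))); first exact: aug_inj.
  apply: (bij_inj (ev_bij 0)).
  by rewrite tensor_eval_natural evt !raddf0.
have ev_surj (h : hom C (ctensor C F)) : exists t, tensor_eval C F C t = h.
  have [inv _ invK] := ev_bij 0.
  (* Restricting h along the augmentation gives a cocycle in degree 0; its preimage under the
     evaluation therefore comes from Hom_S(C, C) (x) F. *)
  have [|u uE] := (Fflat augE (inv (precomp _ (pr_aug P) h))).1.
    apply: (bij_inj (ev_bij 1)); rewrite tensor_eval_natural invK raddf0.
    by apply: homP => p /=; rewrite projres_aug_d linear0.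
  by exists u; apply: aug_inj; rewrite -tensor_eval_natural uE invK.
pose inv h := sval (cid (ev_surj h)).
have invK : cancel inv (tensor_eval C F C) by move=> h; exact: svalP (cid (ev_surj h)).
by exists inv => // t; apply: ev_inj; rewrite invK.
Qed.

(** The map [mu] is m |-> id_C (x) m followed by the evaluation at [C]; the first map is bijective
    because the homothety identifies [R] with Hom_S(C, C). *)
Lemma flat_mu_bij : bijective (@mu _ _ C F).
Proof.
have [rinv rinvK rK] := semidualizing_b2 hC.
(* This is the identity of [C], written as a homothety so that [rinv] sends it to 1 by
   cancellation. *)
pose unit : homr C (C : lmodType S) := homothety_r C 1.
have rinvD f g : rinv (f + g) = rinv f + rinv g.
  apply: (can_inj rinvK); rewrite rK.
  by apply: homP => c; rewrite /= rscaleDr -{1}[f]rK -{1}[g]rK.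
have rinvZ r (f : homr C (C : lmodType S)) :
    rinv ((r : R^c) *: f) = rinv f * r.
  apply: (can_inj rinvK); rewrite rK.
  by apply: homP => c; rewrite /= -rscaleA -{1}[f]rK.
have act_balanced : balanced (fun (g : homr C (C : lmodType S)) (m : F) => rinv g *: m).
  split=> [f g m|g m m'|r g m]; first by rewrite rinvD scalerDl.
    exact: scalerDr.
  by rewrite rinvZ scalerA.
pose act : {additive tensor (homr C (C : lmodType S)) F -> F} := tensor_lift act_balanced.
have unit_bij : bijective (fun m : F => tens unit m).
  exists act => [m|t]; first by rewrite [LHS]tensor_liftE rinvK scale1r.
  pose tu : {additive F -> tensor (homr C (C : lmodType S)) F} :=
    HB.pack (tens unit) (GRing.isZmodMorphism.Build _ _ _ (@tensBr _ _ F unit)).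
  apply: (tensor_additive_ext (f := tu \o act) (g := idfun)) => g m.
  rewrite -[LHS]/(tens unit (act (tens g m))) [act _]tensor_liftE.
  rewrite -tensZ; congr tens; rewrite -[RHS]rK.
  by apply: homP => c; rewrite /= rscaleA mul1r.
apply: (eq_bij (bij_comp flat_tensor_eval_bij unit_bij)) => m.
by apply: homP => c; rewrite /= tensor_evalE /= rscale1.
Qed.

Lemma flat_auslander : auslander C F.
Proof.
split; [case=> // j _; exact: flat_Tor_eq0 | case=> // j _; exact: flat_Ext_eq0 |].
exact: flat_mu_bij.
Qed.

End FlatAuslander.

(** * Injective modules lie in the Bass class *)

Section InjectiveBass.
Variables (S R : pzRingType) (C : bimodType S R) (I : lmodType S).
Hypotheses (hC : semidualizing C) (Iinj : injective_module I).

Lemma injective_Ext_eq0 (M : lmodType S) j : Ext_eq0 M I j.+1.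
Proof.
move=> P; apply/homology_eq0P => f fd.
have [p|h hE] := extend_through_exact (k := f) Iinj (pr_exactS P j).
  exact: (congr1 (hom_at p) fd).
by exists (mkhom (linearP h)); apply: homP.
Qed.

Lemma injective_precomp_exact (X Y Z : lmodType S)
    (f : {linear X -> Y}) (g : {linear Y -> Z}) :
  exact_at f g -> exact_at (precomp I g) (precomp I f).
Proof.
move=> fg k; split=> [kf|[h <-]].
  have [x|h hE] := extend_through_exact (k := k) Iinj fg.
    exact: (congr1 (hom_at x) kf).
  by exists (mkhom (linearP h)); apply: homP.
by apply: homP => x /=; rewrite (fg (f x)).2 ?linear0 //; exists x.
Qed.

Lemma injective_Tor_eq0 j : Tor_eq0 (rmod C : lmodType R^c) (chom C I) j.+1.
Proof.
have [Q Qfin] := semidualizing_a2 hC.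
apply: (Tor_eq0_projres (Q := Q)); apply/homology_eq0P => t dt.
have ev_bij n := hom_eval_bij C I (pr_projective Q n) (Qfin n).
have [inv _ invK] := ev_bij j.+2.
have CC : exact_at (homl_map C (pr_d Q j)) (homl_map C (pr_d Q j.+1)).
  by apply: Ext_eq0_exact; exact: semidualizing_c2.
(* Hom(-, I) reverses the arrows a second time, so the result is a chain complex comparable with Q
   (x) Hom_S(C, I). *)
have [|k kE] := (injective_precomp_exact CC (hom_eval C I _ t)).1.
  by rewrite -hom_eval_natural dt raddf0.
exists (inv k); apply: (bij_inj (ev_bij j.+1)).
by rewrite hom_eval_natural invK.
Qed.

(** Dual to the flat case: two right exact sequences are compared in degrees 0 and 1. *)
Lemma injective_hom_eval_bij : bijective (hom_eval C I (rmod C)).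
Proof.
have [Q Qfin] := semidualizing_a2 hC.
have ev_bij n := hom_eval_bij C I (pr_projective Q n) (Qfin n).
have aug_inj : injective (homl_map C (pr_aug Q)).
  move=> f g fg; apply: homP => c; have [q <-] := pr_aug_surj Q c.
  exact: (congr1 (hom_at q) fg).
have augE : exact_at (homl_map C (pr_aug Q)) (homl_map C (pr_d Q 0)).
  exact: (precomp_left_exact (pr_exact0 Q) (pr_aug_surj Q)).
have ev_inj : injective (hom_eval C I (rmod C)).
  apply: raddf_inj => t evt.
  (* A lift u of t to degree 0 is shown to be a boundary, and boundaries die under the
     augmentation. *)
  have [u uE] := tensor_map_surj (M := chom C I) (pr_aug_surj Q) t.
  have [|k kE] := (injective_precomp_exact augE (hom_eval C I _ u)).1.
    by rewrite -hom_eval_natural uE.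
  have [inv _ invK] := ev_bij 1.
  have du : u = tensor_map _ (pr_d Q 0) (inv k).
    by apply: (bij_inj (ev_bij 0)); rewrite hom_eval_natural invK.
  rewrite -uE du tensor_map_comp (eq_tensor_map (g := \0)) ?tensor_map0 //.
  exact: projres_aug_d.
have ev_surj (k : hom (homl C (rmod C)) I) : exists t, hom_eval C I (rmod C) t = k.
  (* Hom(C, C) embeds in Hom(Q_0, C), so k extends there, where the evaluation is already known to
     be bijective. *)
  have [k' k'E] := Iinj k aug_inj.
  have [inv _ invK] := ev_bij 0.
  exists (tensor_map _ (pr_aug Q) (inv (mkhom (linearP k')))).
  by rewrite hom_eval_natural invK; apply: homP.
pose inv h := sval (cid (ev_surj h)).
have invK : cancel inv (hom_eval C I (rmod C)).
  by move=> h; exact: svalP (cid (ev_surj h)).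
by exists inv => // t; apply: ev_inj; rewrite invK.
Qed.

(** The map [nu] is the evaluation at [C] followed by k |-> k(id_C). As Hom(C, C) is free over [S]
    on id_C, the second map is bijective. *)
Lemma injective_nu_bij : bijective (@nu _ _ C I).
Proof.
have [linv linvK lK] := semidualizing_b1 hC.
pose unit : homl C (rmod C) := homothety_l C 1.
have linvP : linear (linv : homl C (rmod C) -> S^o).
  move=> s f g; apply: (can_inj linvK); rewrite lK; apply: homP => c.
  have lKc h : linv h *: (c : C) = (h : hom (rmod C) (rmod C)) c.
    exact: (congr1 (hom_at (c : rmod C)) (lK h)).
  rewrite -[RHS]/((s * linv f + linv g) *: (c : C)) scalerDl -scalerA.
  by rewrite !lKc.
have at_unit_bij : bijective (fun k : hom (homl C (rmod C)) I => k unit).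
  have actP (y : I) : linear (fun g : homl C (rmod C) => linv g *: y).
    by move=> s f g; rewrite linvP scalerDl scalerA.
  exists (fun y => mkhom (actP y)) => [k|y]; last by rewrite /= linvK scale1r.
  (* Every g equals [linv g *: unit], so k is determined by its value at [unit]. *)
  apply: homP => g /=; rewrite -linearZ; congr (k _); rewrite -[RHS]lK.
  by apply: homP => c; rewrite /= scalerA mulr1.
apply: (eq_bij (bij_comp at_unit_bij injective_hom_eval_bij)) => t.
pose lhs : {additive tensor (rmod C) (chom C I) -> I} :=
  hom_at unit \o hom_eval C I (rmod C).
rewrite -[LHS]/(lhs t); apply: tensor_additive_ext => c f.
rewrite [RHS]tensor_liftE -[LHS]/(hom_eval C I _ (tens c f) unit) hom_evalE.
by congr (Defs.hom_fun f _); exact: (scale1r (c : C)).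
Qed.

Lemma injective_bass : bass C I.
Proof.
split; [case=> // j _; exact: injective_Ext_eq0 | case=> // j _; exact: injective_Tor_eq0 |].
exact: injective_nu_bij.
Qed.

End InjectiveBass.

Theorem lemma4p4 (S R : pzRingType) (C : bimodType S R) (hC : semidualizing C) :
  (forall F : lmodType R, flat F -> auslander C F) /\
  (forall I : lmodType S, injective_module I -> bass C I).
Proof.
by split=> M; [exact: flat_auslander | exact: injective_bass].
Qed.
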